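(* The zeros of all the polynomials $F_n(z)$, $n\ge 1$, are densely distributed on the left half of the circle $|z-1|=2$. That is, writing $C=\{z\in\mathbb C: |z-1|=2,\ \operatorname{Re} z\le 1\}$, every complex zero of every $F_n$ lies in $C$, and the set $\bigcup_{n\ge 1}\{z\in\mathbb C: F_n(z)=0\}$ is dense in $C$.
   Context: For $n\ge 1$, $F_n(z)=\sum_{m}A(n,m)z^m$, where $A(n,m)$ is the number of integer partitions with exactly $m$ even parts (counted with multiplicity) and largest hook length $n$ (the largest hook length of a partition $\lambda$ is $\lambda_1+\ell(\lambda)-1$, with $\lambda_1$ the largest part and $\ell(\lambda)$ the number of parts). Equivalently (a known fact recalled in the paper), $F_1(z)=1$, $F_2(z)=1+z$, and $F_n(z)=(1+z)F_{n-1}(z)+(1-z)F_{n-2}(z)$ for $n\ge 3$. *)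

(* Defs.v *)
From HB Require Import structures.
From mathcomp Require Import all_boot all_order all_algebra.
From mathcomp Require Import finmap.
From mathcomp Require Import complex.
From mathcomp Require Import all_classical all_reals all_analysis.
Set Implicit Arguments.
Unset Strict Implicit.
Unset Printing Implicit Defensive.
Import Order.TTheory GRing.Theory Num.Theory numFieldNormedType.Exports.
Local Open Scope classical_set_scope.
Local Open Scope ring_scope.

(* An integer partition is the weakly decreasing sequence of its parts. *)
Definition is_partition (s : seq nat) : bool := sorted geq s && (0%N \notin s).

(* lambda_1 + l(lambda) - 1; the junk value on the empty partition is 0. *)
Definition largest_hook (s : seq nat) : nat := (head 0 s + size s).-1.

Definition even_parts (s : seq nat) : nat := count (fun k => ~~ odd k) s.

Definition hook_partitions (n m : nat) : set (seq nat) :=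
  [set s | [/\ is_partition s, largest_hook s = n & even_parts s = m]].

(* [fset_set] is meaningful here by [finite_hook_partitions] below. *)
Definition A (n m : nat) : nat := #|` fset_set (hook_partitions n m)|%fset.

(* Truncating at degree n loses nothing, by [A_eq0] below. *)
Definition F (K : nzRingType) (n : nat) : {poly K} := \poly_(m < n.+1) (A n m)%:R.

(* [R[i]^o] is [R[i]] carrying the topology of its norm. *)
Definition left_half_circle (R : realType) : set R[i]^o :=
  [set z : R[i] | `|z - 1| = 2 /\ complex.Re z <= 1].

Definition zeros_F (R : realType) : set R[i]^o :=
  [set z : R[i] | exists2 n : nat, (0 < n)%N & root (F R[i] n) z].

Arguments left_half_circle : clear implicits.
Arguments zeros_F : clear implicits.

Lemma hook_partition_bounds (n m : nat) (s : seq nat) :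
  hook_partitions n m s -> (size s <= n)%N /\ all (fun k => k <= n)%N s.
Proof.
case=> /andP[]; case: s => [|a s] //=.
rewrite inE negb_or => srt /andP[a0 _]; rewrite /largest_hook /= => hk _.
have a_gt0 : (0 < a)%N by rewrite lt0n eq_sym.
rewrite addnS /= in hk.
have an : (a <= n)%N by rewrite -hk leq_addr.
split; first by rewrite -hk -add1n leq_add2r.
rewrite an /=.
have geq_trans : transitive geq by move=> y x z xy yz; exact: leq_trans yz xy.
have := order_path_min geq_trans srt.
by apply: sub_all => k ka; exact: leq_trans ka an.
Qed.

Lemma finite_hook_partitions (n m : nat) : finite_set (hook_partitions n m).
Proof.
apply: (@sub_finite_set _ _
  [set` [seq map val (bseqval t) | t <- enum {: n.-bseq 'I_n.+1}]]);
  last exact: finite_seq.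
move=> s /hook_partition_bounds[sz /allP bd] /=.
have sz' : (size [seq inord k : 'I_n.+1 | k <- s] <= n)%N by rewrite size_map.
apply/mapP; exists (Bseq sz'); first by rewrite mem_enum.
rewrite /= -map_comp -[LHS]map_id; apply/eq_in_map => k /bd kn /=.
by rewrite inordK.
Qed.

Lemma A_eq0 (n m : nat) : (n < m)%N -> A n m = 0%N.
Proof.
move=> nm; rewrite /A (_ : hook_partitions n m = set0) ?fset_set0 ?cardfs0//.
apply/seteqP; split=> // s hs; have [sz _] := hook_partition_bounds hs.
case: hs => _ _ em; have : (even_parts s <= n)%N.
  exact: leq_trans (count_size _ s) sz.
by rewrite em leqNgt nm.
Qed.

(* Main.v *)
(* A partition of hook length n >= 2 arises in exactly one way from one of hook
   length n - 1, either by repeating the largest part or by increasing it by 1.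
   Splitting by the parity of the largest part gives a 2 x 2 transfer matrix of
   trace 1 + z and determinant z - 1, so F_n(z) is the sum of t1^i t2^(n-1-i)
   where t1, t2 are its eigenvalues.  At a zero, t1^n = t2^n, hence
   |t1| = |t2|; with (t1 - 1)(t2 - 1) = -1 this forces |t1 t2| = 2 and
   Re (t1 t2) <= 0, where t1 t2 = z - 1.  Conversely z = 1 + w^2 with
   w = cos x +- i sqrt(2 - cos^2 x) has eigenvalues w e^(ix), w e^(-ix), so it
   is a zero of F_n whenever x is k pi / n with 0 < k < n, and as x runs over
   [0, pi] these z cover the left half circle. *)
Require Import Defs.
From mathcomp Require Import all_boot all_order all_algebra.
From mathcomp Require Import finmap.
From mathcomp Require Import complex.
From mathcomp Require Import all_classical all_reals all_analysis.
From mathcomp Require Import ring lra zify.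
Set Implicit Arguments.
Unset Strict Implicit.
Unset Printing Implicit Defensive.
Import Order.TTheory GRing.Theory Num.Theory numFieldNormedType.Exports.
Local Open Scope classical_set_scope.
Local Open Scope ring_scope.

(** * Enumeration of partitions by largest hook length *)

Definition repeat_head (s : seq nat) : seq nat :=
  if s is a :: s' then [:: a, a & s'] else [::].

Definition incr_head (s : seq nat) : seq nat :=
  if s is a :: s' then a.+1 :: s' else [::].

(* [hook_seqs n] lists the partitions with largest hook length [n.+1]. *)
Fixpoint hook_seqs (n : nat) : seq (seq nat) :=
  if n is n'.+1 then
    map repeat_head (hook_seqs n') ++ map incr_head (hook_seqs n')
  else [:: [:: 1%N]].

Lemma repeat_head_inj : injective repeat_head.
Proof. by case=> [|a s] [|b t] //= [-> _ ->]. Qed.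

Lemma incr_head_inj : injective incr_head.
Proof. by case=> [|a s] [|b t] //= [-> ->]. Qed.

Lemma is_partition_cons (a : nat) (s : seq nat) :
  is_partition (a :: s) = [&& head 0%N s <= a, 0 < a & is_partition s]%N.
Proof.
rewrite /is_partition inE negb_or; case: s => [|b s] /=.
  by case: a.
by case: a => [|a]; rewrite ?andbF ?ltnn /= ?andbA.
Qed.

(** Each growth step can be undone: if the two largest parts agree, drop one copy; otherwise lower
    the largest part by 1, which keeps the parts weakly decreasing. *)
Lemma mem_hook_seqs (n : nat) (s : seq nat) :
  (s \in hook_seqs n) = is_partition s && (largest_hook s == n.+1).
Proof.
elim: n s => [|n IH] s.
  rewrite inE; case: s => [|a [|b s]] //=.
    rewrite is_partition_cons /largest_hook /= addn1 /= andbT.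
    by rewrite eqseq_cons andbT; case: a.
  rewrite !is_partition_cons /largest_hook /= eqseq_cons andbF.
  by symmetry; apply/negbTE; lia.
rewrite mem_cat; apply/orP/idP.
  by case=> /mapP[[|a t]]; rewrite IH ?andbF // !is_partition_cons
       /largest_hook /= => /andP[/and3P[h1 h2 h3] /eqP h4] ->;
     rewrite !is_partition_cons /= h3; lia.
case: s => [|a [|b s]] //.
- rewrite is_partition_cons /largest_hook /= => h; right.
  apply/mapP; exists [:: a.-1] => /=; last by congr (_ :: _); lia.
  by rewrite IH is_partition_cons /largest_hook /=; lia.
- rewrite !is_partition_cons /largest_hook /=.
  move=> /andP[/and3P[ba a0 /and3P[sb b0 ps]] hk].
  have [ab|ab] := eqVneq a b; [left|right]; apply/mapP.
    exists (b :: s); last by rewrite ab.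
    by rewrite IH is_partition_cons /largest_hook /= ps; lia.
  exists [:: a.-1, b & s]; last by rewrite /=; congr (_ :: _); lia.
  by rewrite IH !is_partition_cons /largest_hook /= ps; lia.
Qed.

Lemma uniq_hook_seqs (n : nat) : uniq (hook_seqs n).
Proof.
elim: n => [//|n IH]; rewrite cat_uniq !map_inj_uniq ?IH //=;
  [rewrite andbT|exact: incr_head_inj|exact: repeat_head_inj].
(* The two lists are disjoint: [repeat_head] makes the first two parts equal, [incr_head] makes the
   first strictly exceed the second. *)
apply/hasPn => _ /mapP[s hs ->]; apply/mapP => -[t ht].
move: hs ht; rewrite !mem_hook_seqs.
case: s t => [|a s] [|b t] //=; rewrite !is_partition_cons => h _ [ab st].
by move: h; rewrite st /= -ab ltnn.
Qed.

Lemma A_hook_seqs (n m : nat) :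
  A n.+1 m = count (fun s => even_parts s == m) (hook_seqs n).
Proof.
rewrite /A; have -> : fset_set (hook_partitions n.+1 m) =
    [fset s in [seq s <- hook_seqs n | even_parts s == m]]%fset.
  apply/fsetP => s; rewrite in_fset_set; last exact: finite_hook_partitions.
  rewrite !inE mem_filter mem_hook_seqs; apply/idP/and3P; rewrite inE.
    by case=> -> -> ->; rewrite !eqxx.
  by case=> /eqP ? ? /eqP ?.
by rewrite card_fseq undup_id ?filter_uniq ?uniq_hook_seqs // size_filter.
Qed.

(** * Values of the polynomials through the transfer recurrence *)

Lemma horner_F (K : comNzRingType) (n : nat) (z : K) :
  (F K n.+1).[z] = \sum_(s <- hook_seqs n) z ^+ even_parts s.
Proof.
rewrite /F horner_poly.
have lt_even s : s \in hook_seqs n -> (even_parts s < n.+2)%N.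
  rewrite mem_hook_seqs ltnNge => /andP[ps /eqP hs]; apply/negP => h.
  have [sz _] := @hook_partition_bounds n.+1 (even_parts s) s (And3 ps hs erefl).
  by have := leq_trans h (leq_trans (count_size _ s) sz); rewrite ltnn.
(* Group the partitions by number of even parts; by [lt_even], [inord] does not alter that
   number. *)
rewrite [RHS]big_seq (partition_big (fun s => inord (even_parts s) : 'I_n.+2) xpredT) //=.
apply: eq_bigr => i _; rewrite A_hook_seqs mulr_natl.
rewrite -sum1_count -sumrMnr big_seq_cond; apply: eq_big => s.
  case sn: (s \in _) => //=.
  apply/eqP/eqP => [->|<-]; first exact: inord_val.
  by rewrite inordK ?lt_even.
by move=> /andP[_ /eqP ->].
Qed.

(* The weight omits the head, so that both recurrences below hold without
   dividing by [z]. *)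
Definition odd_head_sum {K : comNzRingType} (z : K) (n : nat) : K :=
  \sum_(s <- hook_seqs n | odd (head 0%N s)) z ^+ even_parts (behead s).

Definition even_head_sum {K : comNzRingType} (z : K) (n : nat) : K :=
  \sum_(s <- hook_seqs n | ~~ odd (head 0%N s)) z ^+ even_parts (behead s).

Lemma nil_hook_seqs (n : nat) : ([::] \in hook_seqs n) = false.
Proof. by rewrite mem_hook_seqs. Qed.

Lemma horner_F_head_sum (K : comNzRingType) (n : nat) (z : K) :
  (F K n.+1).[z] = odd_head_sum z n + z * even_head_sum z n.
Proof.
rewrite horner_F (bigID (fun s => odd (head 0%N s))) mulr_sumr /=.
rewrite /odd_head_sum /even_head_sum; congr (_ + _);
  rewrite big_seq_cond [RHS]big_seq_cond; apply: eq_bigr;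
  move=> [|a s] /andP[]; rewrite ?nil_hook_seqs //= => _ oa.
  by rewrite /even_parts /= oa.
by rewrite /even_parts /= oa exprS.
Qed.

(** An odd head comes from repeating an odd head or increasing an even one; neither adds an even
    part to the tail. *)
Lemma odd_head_sumS (K : comNzRingType) (z : K) (n : nat) :
  odd_head_sum z n.+1 = odd_head_sum z n + even_head_sum z n.
Proof.
rewrite /odd_head_sum big_cat !big_map /=; congr (_ + _);
  rewrite big_seq_cond [RHS]big_seq_cond; apply: eq_big;
  move=> [|a s]; rewrite ?nil_hook_seqs //=.
by rewrite /even_parts /= => /andP[_ ->].
Qed.

(** Repeating an even head puts one more even part in the tail, whence the factor [z]; increasing an
    odd head leaves the tail alone. *)
Lemma even_head_sumS (K : comNzRingType) (z : K) (n : nat) :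
  even_head_sum z n.+1 = odd_head_sum z n + z * even_head_sum z n.
Proof.
rewrite addrC /even_head_sum big_cat !big_map /= mulr_sumr; congr (_ + _);
  rewrite big_seq_cond [RHS]big_seq_cond; apply: eq_big;
  move=> [|a s]; rewrite ?nil_hook_seqs //=.
- by rewrite /even_parts /= => /andP[_ ->]; rewrite exprS.
- by rewrite negbK.
Qed.

Lemma horner_F_expand (K : comNzRingType) (z t1 t2 : K) (n : nat) :
  t1 + t2 = 1 + z -> t1 * t2 = z - 1 ->
  (F K n.+1).[z] = \sum_(i < n.+1) t1 ^+ (n - i) * t2 ^+ i.
Proof.
move=> t12 p12; pose G n := (F K n.+1).[z].
have G0 : G 0%N = 1.
  by rewrite /G horner_F big_seq1.
have G1 : G 1%N = t1 + t2.
  by rewrite /G horner_F /= big_cons big_seq1 t12.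
have GSS k : G k.+2 = (t1 + t2) * G k.+1 - t1 * t2 * G k.
  rewrite /G p12 t12 !horner_F_head_sum.
  by rewrite !(odd_head_sumS, even_head_sumS); ring.
(* By the two-step recurrence, [G k.+1 - t1 * G k] is geometric with ratio [t2]. *)
have GS k : G k.+1 = t1 * G k + t2 ^+ k.+1.
  elim: k => [|k IH]; first by rewrite G1 G0 mulr1 expr1.
  by rewrite GSS (exprS t2 k.+1) IH; ring.
rewrite -/(G n); elim: n => [|n IH].
  by rewrite G0 big_ord1 mulr1.
rewrite GS IH [RHS]big_ord_recr /= subnn mul1r mulr_sumr; congr (_ + _).
apply: eq_bigr => i _.
by rewrite subSn ?exprS ?mulrA // -ltnS.
Qed.

(** * Zeros lie on the left half circle *)

Lemma norm_Re_mul_of_eq_norm (C : numClosedFieldType) (a b : C) :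
  a + b = 2 + a * b -> `|a| = `|b| -> `|a * b| = 2 /\ 'Re (a * b) <= 0.
Proof.
move=> ab nab; pose r := a * a^*.
have aa : a * a^* = r by [].
have bb : b * b^* = r by rewrite /r -!normCK nab.
have ab' : a^* + b^* = 2 + a^* * b^* by rewrite -rmorphM -!rmorphD ab rmorphD rmorph_nat.
(* Multiply the conjugate relation by [a * b]. *)
have : (r - 2) * (a * b - r) = 0.
  have : a * b * (a^* + b^*) = a * b * (2 + a^* * b^*) by rewrite ab'.
  have -> : a * b * (a^* + b^*) = (a + b) * r.
    by rewrite mulrDl -{1}bb -aa; ring.
  have -> : a * b * (2 + a^* * b^*) = 2 * (a * b) + r * r.
    by rewrite -{1}bb -aa; ring.
  by rewrite ab => h; rewrite -(subrr (2 * (a * b) + r * r)) -{1}h; ring.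
move=> /eqP; rewrite mulf_eq0 => /orP[/eqP/subr0_eq r2|/eqP/subr0_eq abr].
  have na : `|a| ^+ 2 = 2 by rewrite normCK aa.
  split; first by rewrite normrM -nab -expr2.
  (* Parallelogram law. Since [a + b = 2 + a * b] has squared modulus [8 + 4 * 'Re (a * b)], what
     remains for [a - b] is [- 4 * 'Re (a * b)], which must be nonnegative. *)
  have h : (a + b) * (a + b)^* + (a - b) * (a - b)^* = 8.
    rewrite rmorphB rmorphD /=.
    have -> : 8 = 2 * (a * a^* + b * b^*) by rewrite aa bb r2; ring.
    by ring.
  have h4 : (a * b) * (a * b)^* = 4.
    by rewrite rmorphM /= mulrACA aa bb r2; ring.
  have : 0 <= (a - b) * (a - b)^* by rewrite -normCK exprn_ge0.
  have -> : (a - b) * (a - b)^* = - 4 * 'Re (a * b).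
    apply: (@addrI _ ((a + b) * (a + b)^*)); rewrite h ab rmorphD rmorph_nat /= ReE.
    rewrite mulrDl !mulrDr h4.
    by field.
  by rewrite mulNr oppr_ge0 pmulr_rle0.
have [b0|b0] := eqVneq b 0.
  move: nab ab; rewrite b0 normr0 => /normr0_eq0 -> /eqP.
  by rewrite mul0r !addr0 eq_sym pnatr_eq0.
(* The case [a * b = r] is impossible: then [`|b - 1| ^+ 2 = -1]. *)
have ab1 : a = b^*.
  by apply: (mulfI b0); rewrite bb mulrC.
have : 0 <= (b - 1) * (b - 1)^* by rewrite -normCK exprn_ge0.
have -> : (b - 1) * (b - 1)^* = -1.
  rewrite rmorphB rmorph1 /= -ab1.
  have -> : (b - 1) * (a - 1) = a * b - (a + b) + 1 by ring.
  by rewrite ab; ring.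
by rewrite oppr_ge0 ler10.
Qed.

Lemma root_F_left_half_circle (R : realType) (n : nat) (z : R[i]) :
  root (F R[i] n.+1) z -> left_half_circle R z.
Proof.
(* [d] is a square root of the discriminant of the characteristic polynomial of the transfer
   matrix. *)
pose d := sqrtC ((1 + z) ^+ 2 - 4 * (z - 1)).
pose t1 := (1 + z + d) / 2; pose t2 := (1 + z - d) / 2.
have t12 : t1 + t2 = 1 + z by rewrite /t1 /t2; field.
have p12 : t1 * t2 = z - 1.
  have -> : t1 * t2 = ((1 + z) ^+ 2 - d ^+ 2) / 4 by rewrite /t1 /t2; field.
  by rewrite sqrtCK; field.
move=> /rootP; rewrite (horner_F_expand n t12 p12) => F0.
have t1t2 : t1 ^+ n.+1 = t2 ^+ n.+1.
  by apply/eqP; rewrite -subr_eq0 subrXX F0 mulr0.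
have nt : `|t1| = `|t2|.
  by apply/eqP; rewrite -(@eqrXn2 _ n.+1) // -!normrX t1t2.
have [|h1 h2] := norm_Re_mul_of_eq_norm _ nt.
  by rewrite t12 p12; ring.
split; first by rewrite -p12.
move: h2; rewrite p12 -complexRe -[X in _ <= X]/((0 : R)%:C)%C lecR raddfB /=.
by rewrite subr_le0.
Qed.

(** * Explicit zeros and their density *)

Lemma expr_cos_sin (R : realType) (x : R) (n : nat) :
  (cos x +i* sin x)%C ^+ n = (cos (x *+ n) +i* sin (x *+ n))%C.
Proof.
elim: n => [|n IH]; first by rewrite mulr0n cos0 sin0.
rewrite exprS IH mulrS cosD sinD; apply/eqP; rewrite eq_complex /=.
by apply/andP; split; apply/eqP; ring.
Qed.

Lemma sin_pi_muln (R : realType) (k : nat) : sin (pi *+ k : R) = 0.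
Proof.
elim: k => [|k IH]; first by rewrite mulr0n sin0.
by rewrite mulrS sinD IH sinpi mul0r mulr0 addr0.
Qed.

Lemma root_F_param (R : realType) (n k : nat) (x b : R) :
  x *+ n.+1 = pi *+ k -> 0 < x < pi -> cos x ^+ 2 + b ^+ 2 = 2 ->
  root (F R[i] n.+1) (1 + (cos x +i* b)%C ^+ 2).
Proof.
move=> xk xpi cb; set w := (cos x +i* b)%C.
pose e := (cos x +i* sin x)%C; pose e' := (cos x -i* sin x)%C.
have cs := cos2Dsin2 x.
have t12 : w * e + w * e' = 1 + (1 + w ^+ 2).
  apply/eqP; rewrite eq_complex /= !expr2 /= in cb *.
  by apply/andP; split; apply/eqP; nra.
have p12 : (w * e) * (w * e') = (1 + w ^+ 2) - 1.
  rewrite mulrACA -expr2.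
  have -> : e * e' = 1.
    apply/eqP; rewrite eq_complex /=; apply/andP; split; apply/eqP; rewrite -?cs; ring.
  by ring.
(* The imaginary part of [e ^+ n.+1] is the sine of a multiple of [pi], so this power equals its
   conjugate. *)
have ee : e' ^+ n.+1 = e ^+ n.+1.
  have -> : e' = (e^*)%C by [].
  by rewrite -rmorphXn /= /e expr_cos_sin xk sin_pi_muln /= oppr0.
have s0 : sin x != 0 by rewrite gt_eqF // sin_gt0_pi.
have w0 : w != 0.
  rewrite eq_complex /=; apply/negP => /andP[/eqP c0 /eqP b0].
  by move: cb => /eqP; rewrite c0 b0 expr0n addr0 eq_sym pnatr_eq0.
apply/rootP; rewrite (horner_F_expand n t12 p12).
(* The eigenvalues differ because [sin x] and [w] are nonzero, so their difference can be
   cancelled. *)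
apply: (@mulfI _ (w * e - w * e')).
  rewrite -mulrBr mulf_neq0 // eq_complex /= negb_and.
  apply/orP; right; rewrite opprK -mulr2n mulrn_eq0 //.
by rewrite -subrXX mulr0 !exprMn ee subrr.
Qed.

Lemma exists_muln_pi_near (R : realType) (x d : R) :
  0 <= x <= pi -> 0 < d ->
  exists y : R, exists n k : nat,
    [/\ `|y - x| < d, 0 < y < pi & y *+ n.+1 = pi *+ k].
Proof.
move=> /andP[x0 xpi] d0; have pi0 := pi_gt0 R.
(* Clipping to [[0, pi]] keeps [y] strictly inside even if [x] is an endpoint. A rational [q] in
   this interval gives [y = q * pi], with [n.+1] its denominator and [k] its numerator. *)
have : Num.max 0 (x - d) / pi < Num.min pi (x + d) / pi.
  rewrite ltr_pM2r ?invr_gt0 // lt_min !gt_max pi0 /=; lra.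
move=> /rat_in_itvoo[q]; rewrite in_itv /= ltr_pdivrMr // ltr_pdivlMr //.
rewrite gt_max lt_min => /andP[/andP[q0 q1] /andP[q2 q3]].
exists (ratr q * pi), `|denq q|.-1%N, `|numq q|%N; split.
- by rewrite ltr_norml; lra.
- by rewrite q0 q2.
- have qgt0 : 0 < q by move: q0; rewrite pmulr_lgt0 // ltr0q.
  have num0 : (0 : int) <= numq q by rewrite numq_ge0 ltW.
  rewrite prednK ?absz_gt0 ?denq_neq0 //.
  rewrite -[LHS]mulr_natr -[RHS]mulr_natl mulrAC; congr (_ * _).
  rewrite !natr_absz (gtr0_norm (denq_gt0 q)) (ger0_norm num0) /ratr mulfVK //.
  by rewrite intr_eq0 denq_neq0.
Qed.

(** Take a square root [a +i* b] of [z - 1]. The modulus gives [a ^+ 2 + b ^+ 2 = 2] and the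
    half-plane gives [a ^+ 2 <= b ^+ 2], so [a] is a cosine; [s] records the sign of [b]. *)
Lemma left_half_circle_param (R : realType) (z : R[i]) :
  left_half_circle R z ->
  exists x s : R, [/\ 0 <= x <= pi, s ^+ 2 = 1 &
    z = 1 + (cos x +i* (s * Num.sqrt (2 - cos x ^+ 2)))%C ^+ 2].
Proof.
case=> zn zr; case E : (sqrtC (z - 1)) => [a b].
have zab : z = 1 + (a +i* b)%C ^+ 2 by rewrite -E sqrtCK; ring.
have ab2 : a ^+ 2 + b ^+ 2 = 2.
  have : ((a ^+ 2 + b ^+ 2)%:C)%C = ((2 : R)%:C)%C.
    rewrite [LHS](@add_Re2_Im2 R (a +i* b)%C) -normrX -E sqrtCK zn.
    by rewrite rmorph_nat.
  by case.
have ab : a ^+ 2 - b ^+ 2 <= 0.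
  by move: zr; rewrite zab expr2 /= !expr2; lra.
have a1 : -1 <= a <= 1 by rewrite !expr2 in ab2 ab; apply/andP; split; nra.
exists (acos a), (if 0 <= b then 1 else -1).
rewrite acos_ge0 // acos_lepi // acosK ?in_itv //=.
have -> : 2 - a ^+ 2 = b ^+ 2 by rewrite -ab2; ring.
rewrite sqrtr_sqr; split=> //; first by case: ifP; rewrite ?sqrrN expr1n.
rewrite zab; congr (1 + (_ +i* _)%C ^+ 2).
by case: ger0P; rewrite ?mul1r ?mulN1r ?opprK.
Qed.

Theorem theorem1p2 (R : realType) :
  zeros_F R `<=` left_half_circle R /\
  left_half_circle R `<=` closure (zeros_F R).
Proof.
split=> [z [[//|n] _ /root_F_left_half_circle //]|].
move=> z /left_half_circle_param[x [s [xpi s2 zE]]] B /nbhs_ballP[e e0 eB].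
pose g (y : R) : R := s * Num.sqrt (2 - cos y ^+ 2).
have ccos : continuous (@cos R) := @continuous_cos R.
have ch : continuous (fun y : R => 2 - cos y ^+ 2).
  move=> y; apply: cvgB; first exact: cvg_cst.
  exact: (continuous_comp (ccos y) (@exprn_continuous R 2 (cos y))).
have cg : continuous g.
  move=> y; apply: cvgM; first exact: cvg_cst.
  exact: (continuous_comp (ch y) (@sqrt_continuous R _)).
(* Real and imaginary parts of the parametrised point, so that continuity is checked over the
   reals. *)
pose X (y : R) : R := 1 + cos y ^+ 2 - g y ^+ 2.
pose Y (y : R) : R := 2 * (cos y * g y).
have gE y : 1 + (cos y +i* g y)%C ^+ 2 = (X y +i* Y y)%C.
  apply/eqP; rewrite eq_complex /X /Y /=.
  by apply/andP; split; apply/eqP; ring.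
have cX : continuous X.
  move=> y; apply: cvgB; first apply: cvgD; first exact: cvg_cst.
    exact: (continuous_comp (ccos y) (@exprn_continuous R 2 (cos y))).
  exact: (continuous_comp (cg y) (@exprn_continuous R 2 (g y))).
have cY : continuous Y.
  move=> y; apply: cvgM; first exact: cvg_cst.
  exact: cvgM (ccos y) (cg y).
(* The radius is a complex number; its positivity makes it real. *)
case: e e0 eB => e ei /=; rewrite ltcE /= => /andP[/eqP -> e0] eB {ei}.
have e2 : 0 < e / 2 by rewrite divr_gt0.
have /nbhs_ballP[d d0 dXY] : \forall y \near x, `|X x - X y| < e / 2 /\ `|Y x - Y y| < e / 2.
  near=> y; split; near: y.
  - exact: (cvgr_dist_lt _ _ (cX x) _ e2).
  - exact: (cvgr_dist_lt _ _ (cY x) _ e2).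
have [y [n [k [yx ypi yn]]]] := exists_muln_pi_near xpi d0.
exists (1 + (cos y +i* g y)%C ^+ 2); split.
  exists n.+1 => //; apply: (root_F_param yn ypi).
  rewrite /g exprMn s2 mul1r sqr_sqrtr; first by ring.
  by rewrite subr_ge0; have := cos2Dsin2 y; have := sqr_ge0 (sin y); lra.
apply: eB; rewrite zE -/(g x) !gE -ball_normE /ball_ /=.
have [|dX dY] := dXY y; first by rewrite -ball_normE /ball_ /= distrC.
rewrite normc_def ltcR /=.
move: (X x - X y) (Y x - Y y) dX dY => u v dX dY.
have /le_lt_trans -> // : Num.sqrt (u ^+ 2 + v ^+ 2) <= `|u| + `|v|.
  rewrite -[leRHS]ger0_norm ?addr_ge0 // -sqrtr_sqr ler_wsqrtr //.
  rewrite sqrrD !real_normK ?num_real // lerD2r lerDl.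
  by rewrite mulrn_wge0 // mulr_ge0.
by rewrite (splitr e) ltrD.
Unshelve. all: by end_near.
Qed.
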